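(* Let $\mathcal{A}$ be a finite alphabet and $\mathcal{P}\subseteq\mathcal{A}^{\mathbb{N}}$ a path set, with shift closure $\overline{\mathcal{P}}=\bigcup_{j\ge 0}\sigma^j(\mathcal{P})$. Then $$H_p(\mathcal{P})=H_{top}(\mathcal{P})=H_{top}(\overline{\mathcal{P}}),$$ and all the $\limsup$'s in the definitions of these three quantities are attained as limits.
   Context: $\mathcal{A}^{\mathbb{N}}$ is the set of one-sided infinite sequences $a_0a_1a_2\cdots$ with $a_i\in\mathcal{A}$, and $\sigma(a_0a_1a_2\cdots)=a_1a_2a_3\cdots$. A labeled directed graph over $\mathcal{A}$ is a finite directed graph $\mathcal{G}$ whose edges carry labels from $\mathcal{A}$; loops and multiple edges are allowed, but the triples (initial vertex, terminal vertex, label) are required to be distinct. A pointed graph $(\mathcal{G},v)$ is such a graph with a distinguished vertex $v$. The path set $X_{\mathcal{G}}(v)$ is the set of all sequences of successive edge labels of one-sided infinite walks in $\mathcal{G}$ starting at $v$; a subset of $\mathcal{A}^{\mathbb{N}}$ is a path set if it equals $X_{\mathcal{G}}(v)$ for some pointed graph over $\mathcal{A}$. For $X\subseteq\mathcal{A}^{\mathbb{N}}$: $N^I_n(X)$ is the number of distinct initial blocks $a_0\cdots a_{n-1}$ of length $n$ of sequences in $X$, and $N_n(X)$ is the number of distinct blocks $a_i\cdots a_{i+n-1}$ ($i\ge 0$) of length $n$ occurring anywhere in sequences in $X$. The path topological entropy is $H_p(X)=\limsup_{n\to\infty}\frac1n\log N^I_n(X)$, and the topological entropy is $H_{top}(X)=\limsup_{n\to\infty}\frac1n\log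 N_n(X)$. In the degenerate case $X=\emptyset$ use the convention $\log 0=-\infty$. *)

(* Defs.v *)
From mathcomp Require Import all_boot all_order all_algebra.
From mathcomp Require Import all_classical all_reals all_analysis.

Set Implicit Arguments.
Unset Strict Implicit.
Unset Printing Implicit Defensive.

Import Order.TTheory GRing.Theory Num.Theory.
Import numFieldNormedType.Exports.

Local Open Scope classical_set_scope.
Local Open Scope ring_scope.

(* An edge is a triple (initial vertex, terminal vertex, label); since the
   edges form a set, the triples are pairwise distinct. *)
Record labeled_graph (A : finType) := LabeledGraph {
  vertex : finType;
  edges : {set vertex * vertex * A}
}.

Definition initial_vertex (A V : finType) (e : V * V * A) : V := e.1.1.
Definition terminal_vertex (A V : finType) (e : V * V * A) : V := e.1.2.
Definition edge_label (A V : finType) (e : V * V * A) : A := e.2.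

Definition infinite_walk (A : finType) (G : labeled_graph A) (v : vertex G)
    (w : nat -> vertex G * vertex G * A) : Prop :=
  [/\ forall i, w i \in edges G,
      initial_vertex (w 0%N) = v
    & forall i, terminal_vertex (w i) = initial_vertex (w i.+1)].

Definition path_set_of (A : finType) (G : labeled_graph A) (v : vertex G) :
    set (nat -> A) :=
  [set x | exists2 w, infinite_walk v w & forall i, x i = edge_label (w i)].

Definition is_path_set (A : finType) (P : set (nat -> A)) : Prop :=
  exists (G : labeled_graph A) (v : vertex G), P = path_set_of v.

Definition one_sided_shift (A : Type) (x : nat -> A) : nat -> A :=
  fun i => x i.+1.

Definition shift_closure (A : Type) (P : set (nat -> A)) : set (nat -> A) :=
  \bigcup_j (iter j (@one_sided_shift A) @` P).

Definition block (A : Type) (x : nat -> A) (i n : nat) : n.-tuple A :=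
  [tuple x (i + k)%N | k < n].

Definition num_initial_blocks (A : finType) (X : set (nat -> A)) (n : nat) :
    nat :=
  #|[set b : n.-tuple A | `[< exists2 x, X x & b = block x 0 n >]]%SET|.

Definition num_blocks (A : finType) (X : set (nat -> A)) (n : nat) : nat :=
  #|[set b : n.-tuple A | `[< exists2 x, X x & exists i, b = block x i n >]]%SET|.

(* [lne] satisfies [lne 0 = -oo], so for the empty set both rates are -oo at
   every n > 0. The term at n = 0 is 0 and is irrelevant to limits. *)
Definition initial_block_rate (R : realType) (A : finType)
    (X : set (nat -> A)) (n : nat) : \bar R :=
  ((n%:R^-1)%:E * lne (num_initial_blocks X n)%:R%:E)%E.

Definition block_rate (R : realType) (A : finType)
    (X : set (nat -> A)) (n : nat) : \bar R :=
  ((n%:R^-1)%:E * lne (num_blocks X n)%:R%:E)%E.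

Definition path_entropy (R : realType) (A : finType) (X : set (nat -> A)) :
    \bar R :=
  limn_esup (initial_block_rate R X).

Definition topological_entropy (R : realType) (A : finType)
    (X : set (nat -> A)) : \bar R :=
  limn_esup (block_rate R X).

(* Main.v *)
(* Every block of a path set P occurs in P at one of finitely many positions
   j < K, independent of its length, because the graph is finite and a walk can
   be spliced at any vertex it visits. A block at position j is determined by an
   initial block of the same length and j more letters, so that, writing I and N
   for the numbers of initial blocks and of all blocks, I_n <= N_n <= C I_n with
   C independent of n. Since N is submultiplicative, Fekete's lemma makes
   ln N_n / n converge, and ln I_n / n has the same limit. Finally P and its
   shift closure have the same blocks. If P is empty, all rates are -oo. *)
Require Import Defs.
From mathcomp Require Import all_boot all_order all_algebra.
From mathcomp Require Import all_classical all_reals all_analysis.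
From mathcomp Require Import lra.

Import Order.TTheory GRing.Theory Num.Theory.
Import numFieldNormedType.Exports.

Local Open Scope classical_set_scope.
Local Open Scope ring_scope.

Lemma subadditive_mulnD (R : realDomainType) (u : nat -> R) (m q r : nat) :
  (forall i j, u (i + j)%N <= u i + u j) -> u (q * m + r)%N <= q%:R * u m + u r.
Proof.
move=> usub; elim: q => [|q IHq]; first by rewrite mul0n mul0r !add0r.
rewrite mulSn -addnA (le_trans (usub _ _))//.
by rewrite -natr1 mulrDl mul1r addrAC [leRHS]addrC lerD2l.
Qed.

(** The limit is the infimum of [u n / n] over n >= 1, finite since [u] is nonnegative. For m with
    [u m / m] within e/2 of it, Euclidean division of n by m leaves an error that is bounded, hence
    at most e/2 after division by a large n. *)
Lemma fekete (R : realType) (u : nat -> R) :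
  (forall n, 0 <= u n) -> (forall m n, u (m + n)%N <= u m + u n) ->
  exists l : R, u n / n%:R @[n --> \oo] --> l.
Proof.
move=> u0 usub.
pose E := [set u n.+1 / n.+1%:R | n in [set: nat]].
have Elb : has_lbound E by exists 0 => _ [n _ <-]; rewrite divr_ge0.
exists (inf E); apply/cvgrPdist_le => e e0.
have e20 : 0 < e / 2 by rewrite divr_gt0.
have [|_ [k _ <-] uk] := inf_adherent e20 (E := E).
  by split => //; exists (u 1%N / 1); exists 0%N.
set m := k.+1 in uk.
(* Nonnegativity makes [B] dominate [u r] for every remainder r < m at once, independently of n. *)
pose B := \sum_(r < m) u r.
near=> n.
have n0 : 0 < n%:R :> R by near: n; exact: nbhs_infty_gtr.
have lEn : inf E <= u n / n%:R.
  apply: ge_inf => //; exists n.-1 => //; rewrite prednK//.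
  by rewrite -(ltr_nat R).
have Bn : B <= e / 2 * n%:R.
  rewrite mulrC -ler_pdivrMr//; near: n; exact: nbhs_infty_ger.
rewrite distrC ger0_norm ?subr_ge0// lerBlDl.
have m0 : 0 < m%:R :> R by rewrite ltr0n.
have urB : u (n %% m)%N <= B.
  have rm : (n %% m < m)%N by rewrite ltn_mod.
  by rewrite /B (bigD1 (Ordinal rm))//= lerDl sumr_ge0.
have un : u n <= (n %/ m)%:R * u m + B.
  rewrite {1}(divn_eq n m) (le_trans (subadditive_mulnD _ _ _ _ _ usub))//.
  by rewrite lerD2l.
rewrite ler_pdivrMr// (le_trans un)//.
have um : (n %/ m)%:R * u m <= (u m / m%:R) * n%:R.
  rewrite mulrAC ler_pdivlMr// mulrAC [leRHS]mulrC ler_wpM2r//.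
  by rewrite -natrM ler_nat leq_trunc_div.
have := ler_wpM2r (ltW n0) (ltW uk); lra.
Unshelve. all: by end_near. Qed.

(** By conversion, [num_initial_blocks P n] is the cardinal of [blocks_at P 0 n], and
    [num_blocks P n] that of [blocks P n] below. *)
Definition blocks_at {A : finType} (P : set (nat -> A)) (i n : nat) :
    {set n.-tuple A} :=
  [set b : n.-tuple A | `[< exists2 x, P x & b = block x i n >]]%SET.

Definition blocks {A : finType} (P : set (nat -> A)) (n : nat) :
    {set n.-tuple A} :=
  [set b : n.-tuple A | `[< exists2 x, P x & exists i, b = block x i n >]]%SET.

Lemma val_block {A : Type} (x : nat -> A) (i n : nat) :
  block x i n = map x (iota i n) :> seq A.
Proof.
by rewrite -[in RHS](addn0 i) iotaDl -map_comp -val_enum_ord -map_comp.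
Qed.

Lemma block_cat {A : Type} (x : nat -> A) (i m n : nat) :
  block x i (m + n) = cat_tuple (block x i m) (block x (i + m) n).
Proof. by apply: val_inj; rewrite /= !val_block iotaD map_cat. Qed.

Lemma card_imset2_le {S T U : finType} (f : S -> T -> U) (B : {set S})
    (C : {set T}) :
  (#|[set f b c | b in B, c in C]%SET| <= #|B| * #|C|)%N.
Proof. by rewrite curry_imset2X -cardsX leq_imset_card. Qed.

Lemma card_blocks_add {A : finType} (P : set (nat -> A)) (m n : nat) :
  (num_blocks P (m + n) <= num_blocks P m * num_blocks P n)%N.
Proof.
apply: leq_trans (card_imset2_le (@cat_tuple m n A) (blocks P m) (blocks P n)).
apply/subset_leq_card/fintype.subsetP => b; rewrite inE => /asboolP[x Px [i ->]].
rewrite block_cat; apply/imset2P; exists (block x i m) (block x (i + m) n) => //.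
  by rewrite inE; apply/asboolP; exists x => //; exists i.
by rewrite inE; apply/asboolP; exists x => //; exists (i + m)%N.
Qed.

Lemma card_blocks_at {A : finType} (P : set (nat -> A)) (i n : nat) :
  (#|blocks_at P i n| <= num_initial_blocks P n * #|A| ^ i)%N.
Proof.
(* The first n + i letters of a sequence split as [c] followed by [d]; dropping i of them leaves the
   block at position i, and [tcast] retypes its length. *)
pose f (c : n.-tuple A) (d : i.-tuple A) : n.-tuple A :=
  tcast (addnK i n) [tuple of drop i (cat_tuple c d)].
rewrite -(card_tuple i A) -cardsT.
apply: leq_trans (card_imset2_le f (blocks_at P 0 n) [set: _]%SET).
apply/subset_leq_card/fintype.subsetP => b; rewrite inE => /asboolP[x Px ->].
apply/imset2P; exists (block x 0 n) (block x n i); last 1 first.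
- apply: val_inj; rewrite /f /= val_tcast /= !val_block -map_cat -[X in _ ++ iota X _]add0n.
  rewrite -iotaD addnC iotaD map_cat drop_size_cat ?add0n//.
  by rewrite size_map size_iota.
- by rewrite inE; apply/asboolP; exists x.
- by rewrite inE.
Qed.

(* For each vertex [u] fix a time [k u] at which some walk from the base point
   visits [u]. A walk that visits [u] at time [i] can be rerouted to visit it at
   time [k u] instead and to continue in the same way from there on. *)
Lemma path_set_recurrence {A : finType} (P : set (nat -> A)) :
  is_path_set P ->
  exists K : nat, forall x i n, P x ->
    exists2 j, (j < K)%N & exists2 y, P y & block y j n = block x i n.
Proof.
move=> [G [v ->]].
have /choice[k kP] (u : vertex G) : exists k : nat,
    (exists w i, infinite_walk v w /\ initial_vertex (w i) = u) ->
    exists2 w, infinite_walk v w & initial_vertex (w k) = u.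
  have [[w [i [vw wi]]]|nu] :=
      pselect (exists w i, infinite_walk v w /\ initial_vertex (w i) = u).
    by exists i => _; exists w.
  (* Default time for a vertex that no walk from [v] visits. *)
  by exists 0%N.
exists (\max_u k u).+1 => x i n [w [wE w0 wS] xw].
pose u := initial_vertex (w i).
have [|w' [w'E w'0 w'S] w'k] := kP u; first by exists w, i; split.
exists (k u); first by rewrite ltnS; exact: leq_bigmax.
pose z t := if (t < k u)%N then w' t else w (i + (t - k u))%N.
exists (fun t => edge_label (z t)); last first.
  apply: eq_from_tnth => t; rewrite !tnth_mktuple xw /z.
  by rewrite ltnNge leq_addr/= addKn.
exists z => //; split=> [t||t]; rewrite /z.
- by case: ifP.
(* If [k u = 0], the new walk starts with [w i], and [u] is then the base point itself. *)
- case: ltnP => // ; rewrite leqn0 => /eqP k0; rewrite k0 subnn addn0.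
  by rewrite -/u -w'k k0.
- case: (ltnP t (k u)) => [tk|kt]; last first.
    by rewrite ltnNge (leqW kt)/= wS subSn// addnS.
  case: ltnP => [_|kt]; first exact: w'S.
  (* The splice: [w'] arrives at [u] just when the tail of [w] departs from it. *)
  have kt1 : k u = t.+1 by apply/eqP; rewrite eqn_leq kt tk.
  by rewrite w'S -kt1 subnn addn0 w'k.
Qed.

Lemma num_initial_blocks_le {A : finType} (P : set (nat -> A)) (n : nat) :
  (num_initial_blocks P n <= num_blocks P n)%N.
Proof.
apply/subset_leq_card/fintype.subsetP => b; rewrite inE => /asboolP[x Px ->].
by rewrite inE; apply/asboolP; exists x => //; exists 0%N.
Qed.

Lemma num_blocks_le {A : finType} (P : set (nat -> A)) : is_path_set P ->
  exists C : nat, forall n, (num_blocks P n <= C * num_initial_blocks P n)%N.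
Proof.
move=> /path_set_recurrence[K recP]; exists (\sum_(j < K) #|A| ^ j)%N => n.
(* Union bound over the positions j < K, each costing a factor [#|A| ^ j]. *)
apply: (@leq_trans #|\bigcup_(j < K) blocks_at P j n|%SET).
  apply/subset_leq_card/fintype.subsetP => b.
  rewrite inE => /asboolP[x Px [i ->]].
  have [j jK [y Py <-]] := recP x i n Px.
  apply/bigcupP; exists (Ordinal jK) => //.
  by rewrite inE; apply/asboolP; exists y.
rewrite big_distrl/=.
apply: (big_ind2 (fun (S : {set n.-tuple A}) k => #|S| <= k)%N).
- by rewrite cards0.
- by move=> S k T l Sk Tl; rewrite (leq_trans (leq_card_setU _ _))// leq_add.
- by move=> j _; rewrite mulnC card_blocks_at.
Qed.

Lemma num_initial_blocks_gt0 {A : finType} (P : set (nat -> A)) (n : nat) :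
  P !=set0 -> (0 < num_initial_blocks P n)%N.
Proof.
move=> [x Px]; apply/card_gt0P; exists (block x 0 n).
by rewrite inE; apply/asboolP; exists x.
Qed.

Lemma block_iter_shift {A : Type} (x : nat -> A) (i j n : nat) :
  block (iter j (@one_sided_shift A) x) i n = block x (j + i) n.
Proof.
apply: eq_from_tnth => t; rewrite !tnth_mktuple -addnA.
by elim: j (i + t)%N => //= j IHj k; rewrite /one_sided_shift IHj addnS.
Qed.

Lemma num_blocks_shift_closure {A : finType} (P : set (nat -> A)) (n : nat) :
  num_blocks (shift_closure P) n = num_blocks P n.
Proof.
apply: eq_card => b; rewrite !inE; apply/asboolP/asboolP.
  by move=> [_ [j _ [x Px <-]] [i ->]]; exists x => //; exists (j + i)%N;
     rewrite block_iter_shift.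
move=> [x Px [i ->]]; exists x; last by exists i.
by exists 0%N => //; exists x.
Qed.

Lemma lne_rate_cvg (R : realType) (N : nat -> nat) (l : R) :
  (forall n, (0 < N n)%N) -> ln (N n)%:R / n%:R @[n --> \oo] --> l ->
  ((n%:R^-1)%:E * lne (N n)%:R%:E)%E @[n --> \oo] --> l%:E.
Proof.
move=> N0 Nl.
rewrite (_ : (fun n => _) = EFin \o (fun n => ln (N n)%:R / n%:R)).
  by apply: cvg_EFin => //; exact: nearW.
by apply/funext => n; rewrite lne_EFin ?ltr0n// -EFinM mulrC.
Qed.

Lemma block_rates_cvg (R : realType) (A : finType) (P : set (nat -> A)) :
  is_path_set P ->
  exists l : \bar R, initial_block_rate R P @ \oo --> l /\
                      block_rate R P @ \oo --> l.
Proof.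
move=> hP; have [->|P0] := eqVneq P set0.
  have rateNy (N : nat -> nat) : (forall n, N n = 0)%N ->
      ((n%:R^-1)%:E * lne (N n)%:R%:E)%E @[n --> \oo] --> (-oo%E : \bar R).
    (* Only eventually constant: at n = 0 the rate is 0, not -oo. *)
    move=> N0; apply: cvg_near_cst; near=> n.
    rewrite N0 le0_lneNy// gt0_muleNy// lte_fin invr_gt0.
    by near: n; exact: nbhs_infty_gtr.
  by exists -oo%E; split; apply: rateNy => n; apply: eq_card0 => b;
    apply/negbTE; rewrite inE; apply/asboolP => -[].
have {}P0 : P !=set0 by apply/set0P.
have I0 n := num_initial_blocks_gt0 P n P0.
have B0 n : (0 < num_blocks P n)%N := leq_trans (I0 n) (num_initial_blocks_le P n).
pose a n : R := ln (num_blocks P n)%:R.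
pose b n : R := ln (num_initial_blocks P n)%:R.
have [l al] : exists l : R, a n / n%:R @[n --> \oo] --> l.
  apply: fekete => [n|m n]; first by rewrite ln_ge0// ler1n.
  rewrite -lnM ?posrE ?ltr0n// -natrM ler_ln ?posrE ?ltr0n ?muln_gt0 ?B0//.
  by rewrite ler_nat card_blocks_add.
exists l%:E; split; apply: lne_rate_cvg => //.
have [C BC] := num_blocks_le P hP.
have C0 : (0 < C)%N by have := leq_trans (B0 0) (BC 0); case: C BC.
(* Lower squeeze bound: [b n >= a n - ln C], and the constant [ln C] vanishes after division by
   n. *)
have aCl : (a n - ln C%:R) / n%:R @[n --> \oo] --> l.
  have -> : (fun n => (a n - ln C%:R) / n%:R) =
      (fun n => a n / n%:R - ln C%:R * n%:R^-1) :> (nat -> R).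
    by apply/funext => n; rewrite mulrBl.
  rewrite -[l]subr0; apply: cvgB => //; rewrite -[0](mulr0 (ln C%:R)).
  apply: cvgMr; apply/gtr0_cvgV0; first by near=> n; near: n; exact: nbhs_infty_gtr.
  exact: cvgr_idn.
apply: (squeeze_cvgr _ aCl al); near=> n.
rewrite !ler_wpM2r ?invr_ge0//.
  by rewrite ler_ln ?posrE ?ltr0n// ler_nat num_initial_blocks_le.
rewrite lerBlDl -lnM ?posrE ?ltr0n// -natrM ler_ln ?posrE ?ltr0n ?muln_gt0 ?C0 ?I0//.
by rewrite ler_nat.
Unshelve. all: by end_near. Qed.

Theorem theorem1p11 (R : realType) (A : finType) (P : set (nat -> A))
    (hP : is_path_set P) :
  (path_entropy R P = topological_entropy R P /\
   topological_entropy R P = topological_entropy R (shift_closure P)) /\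
  [/\ initial_block_rate R P @ \oo --> path_entropy R P,
      block_rate R P @ \oo --> topological_entropy R P
    & block_rate R (shift_closure P) @ \oo -->
        topological_entropy R (shift_closure P)].
Proof.
have [l [Il Bl]] := block_rates_cvg R A P hP.
have closE : block_rate R (shift_closure P) = block_rate R P.
  by apply/funext => n; rewrite /block_rate num_blocks_shift_closure.
rewrite /path_entropy /topological_entropy closE.
(* The limsup of a convergent sequence is its limit, so every entropy becomes [l]. *)
by rewrite (cvg_limn_einf_sup Il).2 (cvg_limn_einf_sup Bl).2.
Qed.
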